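(* If $Q$ is a nonassociative extra loop and $A(Q)$ is finite, then $|Z(Q)\cap A(Q)| > 1$.
   Context: A loop is a set with a binary operation having a two-sided identity $1$ and such that for all $a,b$ the equations $ax=b$ and $ya=b$ have unique solutions. In products, juxtaposition binds more tightly than $\cdot$. An extra loop is a loop that is both conjugacy closed and Moufang; equivalently (and this may be taken as the definition) a loop satisfying the identity $(xy\cdot z)\cdot x = x\cdot(y\cdot zx)$. For $x,y,z$ in a loop $Q$ the associator $(x,y,z)\in Q$ is defined by $(x\cdot yz)\,(x,y,z)=xy\cdot z$, and $A(Q)$ is the subloop of $Q$ generated by all associators. The nucleus $N(Q)$ is the set of elements that associate with all pairs of elements of $Q$ in every position, and the center $Z(Q)$ is the set of elements of $N(Q)$ that commute with every element of $Q$. *)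

(* Defs.v *)
From HB Require Import structures.
From mathcomp Require Import all_boot all_classical.

Set Implicit Arguments.
Unset Strict Implicit.
Unset Printing Implicit Defensive.

Local Open Scope classical_set_scope.
Local Open Scope group_scope.

HB.mixin Record UMagma_isLoop Q of UMagma Q := {
  ex_unique_ldiv : forall a b : Q, exists! x : Q, a * x = b;
  ex_unique_rdiv : forall a b : Q, exists! y : Q, y * a = b
}.

#[short(type="loopType")]
HB.structure Definition Loop := {Q of UMagma Q & UMagma_isLoop Q}.

Section Loops.
Variable Q : loopType.
Implicit Types a b x y z : Q.

(* The default value 1 is never reached, by ldivP and rdivP. *)
Definition ldiv a b : Q := xget 1 [set x | a * x = b].
Definition rdiv b a : Q := xget 1 [set y | y * a = b].

Lemma ldivP a b x : a * x = b <-> x = ldiv a b.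
Proof.
have [u [abu uniq_u]] := ex_unique_ldiv a b.
have abq : a * ldiv a b = b by rewrite /ldiv; case: xgetP => [? _ //|/(_ u)].
by split=> [abx|->//]; rewrite -(uniq_u x abx) -(uniq_u _ abq).
Qed.

Lemma rdivP a b y : y * a = b <-> y = rdiv b a.
Proof.
have [u [abu uniq_u]] := ex_unique_rdiv a b.
have abq : rdiv b a * a = b by rewrite /rdiv; case: xgetP => [? _ //|/(_ u)].
by split=> [aby|->//]; rewrite -(uniq_u y aby) -(uniq_u _ abq).
Qed.

Definition associator x y z : Q := ldiv (x * (y * z)) ((x * y) * z).

Lemma associatorP x y z : (x * (y * z)) * associator x y z = (x * y) * z.
Proof. exact/ldivP. Qed.

Definition is_subloop (H : set Q) : Prop :=
  [/\ H 1,
      forall x y, H x -> H y -> H (x * y),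
      forall x y, H x -> H y -> H (ldiv x y) &
      forall x y, H x -> H y -> H (rdiv x y)].

Definition associator_subloop : set Q :=
  smallest is_subloop [set a | exists x y z, a = associator x y z].

Definition nucleus : set Q :=
  [set a | forall x y, [/\ a * (x * y) = (a * x) * y,
                           x * (a * y) = (x * a) * y &
                           x * (y * a) = (x * y) * a]].

Definition loop_center : set Q :=
  [set a | nucleus a /\ forall x, commute a x].

Definition extra_loop : Prop :=
  forall x y z, ((x * y) * z) * x = x * (y * (z * x)).

End Loops.

Arguments ldiv {Q} a b.
Arguments rdiv {Q} b a.
Arguments associator {Q} x y z.
Arguments is_subloop {Q} H.
Arguments associator_subloop Q : clear implicits.
Arguments nucleus Q : clear implicits.
Arguments loop_center Q : clear implicits.
Arguments extra_loop Q : clear implicits.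

(* Main.v *)
Require Import Defs.
From mathcomp Require Import all_boot finmap all_classical.

Local Open Scope classical_set_scope.

(** The idea is the one that gives a nontrivial p-group a nontrivial center: a
finite 2-group acting on a nontrivial finite 2-group has a nontrivial fixed
point.  Here [Q] acts on [A(Q)] by conjugation, [a ^ w = w^-1 (a w)], and a fixed
point of the action that lies in [A(Q)], hence in the nucleus, is central.

To make this work one needs four facts about an extra loop [Q] with nucleus [N].

- Squares are nuclear ([nuc_sqr]) and [N] is normal ([nuc_conj]), so modulo [N]
  every element equals its inverse and the product is commutative.  Conjugacy
  closedness [(x y x^-1)(x z) = x(y z)] then reads [y(x z) = x(y z)] modulo [N],
  and together with commutativity this is associativity: associators are nuclear
  ([nuc_associator]).

- The left inner map [z |-> (x y)^-1 (x (y z))] is an automorphism ([linnerM]).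
  It fixes [N] pointwise and sends [z] to [z (x,y,z)^-1].  Applied to a product
  [m z] with [m] nuclear, it shows that associators centralize [N]
  ([associator_nucC]); applied to [z z], which is nuclear, it shows that [z]
  inverts [(x,y,z)] ([associator_conj_last]).

- The extra identity makes associators invariant under cyclic permutation, so
  [x], [z] and also [z x] invert [a = (x,y,z) = (x,y,zx)].  Inverting twice by
  [z] and then [x] is the identity, hence [a = a^-1] ([associator_sqr]).
  Consequently [A(Q)] is an elementary abelian 2-group central in [N]
  ([associator_subloopP]).

- The pentagon of the five bracketings of [x y z w] writes a conjugate of an
  associator through associators ([associator_conj]), so [A(Q)] is invariant
  under conjugation.

As [N] acts trivially on [A(Q)], the action factors through the group [Q/N] of
exponent 2: conjugations are commuting involutive automorphisms of [A(Q)].  If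
[a <> 1] is moved by [w], then [a (a ^ w)] is not 1 and has a strictly smaller
orbit than [a], because [u |-> u (u ^ w)] maps the orbit of [a] onto its orbit
and identifies [a] with [a ^ w].  Orbits being finite, one reaches a fixed point
([exists_conj_fixed]). *)

Section ExtraLoop.
Set Implicit Arguments.
Unset Strict Implicit.
Local Open Scope group_scope.
Variable Q : loopType.
Hypothesis extraQ : extra_loop Q.
Implicit Types a b c n w x y z u v : Q.

Definition loop_inv x : Q := ldiv x 1.
Local Notation "x ^-1" := (loop_inv x) : group_scope.

Definition loop_conj a w : Q := w^-1 * (a * w).
Local Notation "a ^ w" := (loop_conj a w) : group_scope.

Local Notation N := (nucleus Q).
Local Notation A := (associator_subloop Q).

(** * Inverses *)

Lemma lmulI x : injective ( *%g x).
Proof.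
by move=> u v xuv; rewrite (proj1 (ldivP x _ u) xuv); apply/esym/ldivP.
Qed.

Lemma flexible x y : x * y * x = x * (y * x).
Proof. by have := extraQ x 1 y; rewrite mulg1 mul1g. Qed.

Lemma mulxV x : x * x^-1 = 1.
Proof. exact/ldivP. Qed.

Lemma mulxVK x y : x * (x^-1 * y) = y.
Proof.
have [u [ux _]] := ex_unique_rdiv x y.
by have := extraQ x x^-1 u; rewrite mulxV mul1g ux.
Qed.

Lemma mulVxK x y : x^-1 * (x * y) = y.
Proof. by apply: (@lmulI x); rewrite mulxVK. Qed.

Lemma mulVx x : x^-1 * x = 1.
Proof. by have := mulVxK x 1; rewrite mulg1. Qed.

Lemma invK x : x^-1^-1 = x.
Proof. by apply: (@lmulI x^-1); rewrite mulxV mulVx. Qed.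

Lemma mulKxV y x : y * x^-1 * x = y.
Proof.
have -> : y = x * (x^-1 * y) by rewrite mulxVK.
by rewrite [LHS]extraQ mulVx mulg1.
Qed.

Lemma mulKVx y x : y * x * x^-1 = y.
Proof. by have := mulKxV y x^-1; rewrite invK. Qed.

Lemma rmulI x : injective ( *%g^~ x).
Proof. by move=> u v /= uv; rewrite -(mulKVx u x) uv mulKVx. Qed.

Lemma invM x y : (x * y)^-1 = y^-1 * x^-1.
Proof.
have -> : y^-1 = (x * y)^-1 * x by rewrite -[X in _ * X](mulKVx x y) mulVxK.
by rewrite mulKVx.
Qed.

(** * Conjugacy closedness, the Moufang identity and nuclear squares *)

(** In a loop with inverses, an identity [f y * g z = h (y * z)] can be solved for
either factor on the left; doing so here yields both conjugacy laws below. *)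
Lemma extra_autotopism x y z : x^-1 * (y * z * x) = (x^-1 * y) * (z * x).
Proof. by apply: (@lmulI x); rewrite mulxVK -extraQ mulxVK. Qed.

Lemma conj_mull x y z : y ^ x * (x^-1 * z) = x^-1 * (y * z).
Proof.
have := extra_autotopism x (y * z) z^-1.
rewrite mulKVx -/(y ^ x) => ->.
have -> : x^-1 * z = (z^-1 * x)^-1 by rewrite invM invK.
by rewrite mulKVx.
Qed.

Lemma conj_mulr x y z : (y * x) * z ^ x = y * z * x.
Proof.
have := extra_autotopism x y^-1 (y * z).
rewrite mulVxK -/(z ^ x) => ->.
have -> : y * x = (x^-1 * y^-1)^-1 by rewrite invM !invK.
by rewrite mulVxK.
Qed.

Lemma mul_conj x y : x * y ^ x = y * x.
Proof. exact: mulxVK. Qed.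

(** The two conjugacy laws compose to the Moufang identity, by substituting
[y x] and [z ^ x] in the left one. *)
Lemma moufang x y z : (x * y) * (z * x) = x * (y * z * x).
Proof.
rewrite -(conj_mulr x y z).
have := conj_mull x^-1 (y * x) (z ^ x).
by rewrite invK /loop_conj invK mulKVx mulxVK.
Qed.

(** The Moufang identity and [extra_autotopism] differ only in the sign of [x] on
the right factor, which therefore cancels when they are composed. *)
Lemma sqr_mull x y z : (x * (x * y)) * z = x * (x * (y * z)).
Proof.
have := extra_autotopism x^-1 (x * y) (z * x).
by rewrite invK mulKVx moufang -flexible mulKVx => <-.
Qed.

(** * The nucleus is a normal subloop *)

Lemma left_nucleus_nucleus a :
  (forall x y, a * (x * y) = a * x * y) -> N a.
Proof.
move=> aL.
have aVL x y : a^-1 * (x * y) = a^-1 * x * y.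
  by apply: (@lmulI a); rewrite mulxVK aL mulxVK.
move=> x y; split=> //.
- apply: (@lmulI (x * a)^-1); rewrite [RHS]mulVxK.
  by rewrite invM -aVL !mulVxK.
- have := aVL y^-1 x^-1 => /(congr1 loop_inv).
  by rewrite !invM !invK => ->.
Qed.

Lemma nucL a x y : N a -> a * (x * y) = a * x * y.
Proof. by case/(_ x y). Qed.

Lemma nucM a x y : N a -> x * (a * y) = x * a * y.
Proof. by case/(_ x y). Qed.

Lemma nucR a x y : N a -> x * (y * a) = x * y * a.
Proof. by case/(_ x y). Qed.

Lemma nuc1 : N 1.
Proof. by move=> x y; rewrite !mul1g !mulg1. Qed.

Lemma nuc_mul a b : N a -> N b -> N (a * b).
Proof.
move=> Na Nb; apply: left_nucleus_nucleus => x y.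
by rewrite -!(nucL _ _ Na) (nucL _ _ Nb) (nucL _ _ Na).
Qed.

Lemma nuc_inv a : N a -> N a^-1.
Proof.
move=> Na; apply: left_nucleus_nucleus => x y.
by apply: (@lmulI a); rewrite mulxVK (nucL _ _ Na) mulxVK.
Qed.

Lemma nuc_sqr x : N (x * x).
Proof.
have xx y : x * x * y = x * (x * y).
  by have := sqr_mull x 1 y; rewrite mulg1 mul1g.
by apply: left_nucleus_nucleus => y z; rewrite !xx sqr_mull.
Qed.

(** By [conj_mull], conjugation by [x] turns left multiplication by [a] into left
multiplication by [a ^ x]; so the law [a * (p * v) = (a * p) * v] is transported
to [a ^ x]. *)
Lemma nuc_conj a x : N a -> N (a ^ x).
Proof.
move=> Na.
have conjE u : a ^ x * u = x^-1 * (a * (x * u)).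
  by rewrite -conj_mull mulVxK.
have conjM p v : (a * p) ^ x * v = a ^ x * (p ^ x * v).
  rewrite conjE -{1}(mulVxK x v) conj_mull -(nucL _ _ Na).
  by rewrite -{2}(mulVxK x v) conj_mull mulxVK.
apply: left_nucleus_nucleus => u v.
have -> : u = (x * (u * x^-1)) ^ x.
  by rewrite /loop_conj flexible mulKxV mulVxK.
by rewrite -conjM; have := conjM (x * (u * x^-1)) 1; rewrite !mulg1 => ->.
Qed.

(** * The quotient by the nucleus is an abelian group of exponent 2 *)

Definition eq_mod_nuc x y := exists2 n, N n & y = x * n.
Local Notation "x =N y" := (eq_mod_nuc x y) (at level 70).

Lemma eqN_refl x : x =N x.
Proof. by exists 1; rewrite ?mulg1 //; apply: nuc1. Qed.

Lemma eqN_sym x y : x =N y -> y =N x.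
Proof. by case=> n Nn ->; exists n^-1; [apply: nuc_inv | rewrite mulKVx]. Qed.

Lemma eqN_trans x y z : x =N y -> y =N z -> x =N z.
Proof.
case=> n Nn -> [m Nm ->]; exists (n * m); first exact: nuc_mul.
by rewrite (nucR _ _ Nm).
Qed.

Lemma eqN_mul x y u v : x =N y -> u =N v -> x * u =N y * v.
Proof.
case=> n Nn -> [m Nm ->]; exists (n ^ u * m).
  by apply: nuc_mul => //; apply: nuc_conj.
by rewrite !(nucR _ _ Nm) -(nucM _ _ Nn) -(nucR _ _ (nuc_conj _ Nn)) mul_conj.
Qed.

Lemma eqN_inv x : x =N x^-1.
Proof.
exists (x^-1 * x^-1); first exact: nuc_sqr.
by rewrite mulxVK.
Qed.

Lemma eqN_mulC x y : x * y =N y * x.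
Proof.
apply: eqN_trans (eqN_inv _) _; rewrite invM.
by apply: eqN_mul; apply: eqN_sym (eqN_inv _).
Qed.

(** This is [conj_mull] modulo the nucleus, where conjugation is trivial. *)
Lemma eqN_mulCA x y z : x * (y * z) =N y * (x * z).
Proof.
have := conj_mull x^-1 y z; rewrite invK => <-.
apply: eqN_mul (eqN_refl _); rewrite /loop_conj invK.
have := eqN_mulC x (y * x^-1); by rewrite mulKxV.
Qed.

Lemma eqN_mulA x y z : x * (y * z) =N x * y * z.
Proof.
apply: eqN_trans (eqN_mul (eqN_refl x) (eqN_mulC y z)) _.
exact: eqN_trans (eqN_mulCA x z y) (eqN_mulC z (x * y)).
Qed.

Lemma nuc_associator x y z : N (associator x y z).
Proof.
have [n Nn] := eqN_mulA x y z.
by rewrite -(associatorP x y z) => /lmulI ->.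
Qed.

(** * Left inner maps are automorphisms *)

Definition linner x y z := (x * y)^-1 * (x * (y * z)).

(** Three uses of [conj_mull] push the conjugating factors off [w], leaving
[linner x y (z * w) = f z * linner x y w] for some map [f]; the case [w = 1]
identifies [f] with [linner x y]. *)
Lemma linnerM x y z w : linner x y (z * w) = linner x y z * linner x y w.
Proof.
pose f := ((z ^ y^-1) ^ x^-1) ^ (x * y).
have linner_mul u : linner x y (z * u) = f * linner x y u.
  rewrite /linner /f conj_mull; congr (_ * _).
  have := conj_mull y^-1 z u; rewrite invK => <-.
  by have := conj_mull x^-1 (z ^ y^-1) (y * u); rewrite invK => <-.
have linner1 : linner x y 1 = 1 by rewrite /linner mulg1 mulVx.
by rewrite linner_mul -[z in RHS]mulg1 linner_mul linner1 mulg1.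
Qed.

Lemma linner_nuc x y n : N n -> linner x y n = n.
Proof. by move=> Nn; rewrite /linner (nucR _ _ Nn) mulVxK. Qed.

Lemma linnerE x y z : linner x y z = z * (associator x y z)^-1.
Proof.
rewrite /linner -(mulKVx (x * (y * z)) (associator x y z)) associatorP.
by rewrite -(nucR _ _ (nuc_inv (@nuc_associator x y z))) mulVxK.
Qed.

(** * Associators are involutions centralizing the nucleus *)

(** Apply the automorphism [linner x y] to [m z = z n], where [m] and [n] are
nuclear, hence fixed, and [z] goes to [z a^-1]. *)
Lemma associator_nucC x y z n : N n -> commute (associator x y z) n.
Proof.
move=> Nn; pose a := associator x y z; pose m := n ^ z^-1.
have Na : N a^-1 by apply/nuc_inv/nuc_associator.
have Nm : N m by apply: nuc_conj.
have mz : m * z = z * n by rewrite /m /loop_conj invK flexible mulKxV.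
have := linnerM x y m z.
rewrite {1}mz linnerM !(linner_nuc _ _ Nn) (linner_nuc _ _ Nm) linnerE -/a.
rewrite -(nucM _ _ Na) (nucR _ _ Na) mz -(nucR _ _ Na) => /lmulI an.
apply: (@lmulI a^-1).
by rewrite (nucL _ _ Na) mulVx mul1g (nucL _ _ Na) an mulKxV.
Qed.

Lemma conjgM a u v : N a -> a ^ (u * v) = (a ^ u) ^ v.
Proof.
move=> Na; apply: (@lmulI (u * v)); rewrite mul_conj.
rewrite -(nucR _ _ (nuc_conj _ (nuc_conj _ Na))) mul_conj.
by rewrite (nucM _ _ (nuc_conj _ Na)) mul_conj (nucL _ _ Na).
Qed.

Lemma conjMg a b w : N a -> N b -> (a * b) ^ w = a ^ w * b ^ w.
Proof.
move=> Na Nb; apply: (@lmulI w); rewrite mul_conj.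
rewrite (nucR _ _ (nuc_conj _ Nb)) mul_conj.
by rewrite -!(nucL _ _ Na) mul_conj.
Qed.

Lemma conj1 a : a ^ 1 = a.
Proof. by apply: (@lmulI 1); rewrite mul_conj mulg1 mul1g. Qed.

Lemma conj_inj w : injective (loop_conj^~ w).
Proof. by move=> a b /lmulI/rmulI. Qed.

Lemma conj_commute a w : commute a w -> a ^ w = a.
Proof. by move=> aw; rewrite /loop_conj aw mulVxK. Qed.

Lemma conjVg a w : N a -> a^-1 ^ w = (a ^ w)^-1.
Proof.
move=> Na; apply: (@lmulI (a ^ w)).
rewrite mulxV -(conjMg _ Na (nuc_inv Na)) mulxV.
by apply: conj_commute; rewrite /commute mulg1 mul1g.
Qed.

(** The automorphism [linner x y] fixes the nuclear element [z z] and sends [z]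
to [z a^-1], so [a^-1 z a^-1 = z]. *)
Lemma associator_conj_last x y z :
  associator x y z ^ z = (associator x y z)^-1.
Proof.
set a := associator x y z; have Na : N a := @nuc_associator x y z.
have := linnerM x y z z.
rewrite (linner_nuc _ _ (nuc_sqr z)) linnerE -/a.
rewrite -(nucM _ _ (nuc_inv Na)) => /lmulI zE.
by rewrite /loop_conj {2}zE mulxVK mulVxK.
Qed.

(** Moving the parentheses from [(xy.z)x] to [x(y.zx)] costs the factor
[(y,z,x) * (x,y,z)^x], and the extra identity says that it is 1; the second
factor is compared with [(y,z,x)^x = (y,z,x)^-1]. *)
Lemma associator_cycle x y z : associator y z x = associator x y z.
Proof.
set a := associator x y z; set c := associator y z x.
have [Na Nc] : N a /\ N c by split; apply: nuc_associator.
apply: (@conj_inj x); rewrite [LHS]associator_conj_last -/c.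
apply: (@lmulI c); rewrite mulxV.
apply: (@lmulI (x * (y * (z * x)))); rewrite mulg1.
rewrite (nucR _ _ (nuc_conj _ Na)) -(nucR _ _ Nc) associatorP.
rewrite -flexible -(nucR _ _ (nuc_conj _ Na)) mul_conj (nucM _ _ Na).
by rewrite associatorP extraQ.
Qed.

Lemma associator_mulr x y z : associator x y (z * x) = associator y z x.
Proof.
apply: (@lmulI (x * (y * (z * x)))).
by rewrite associatorP moufang -(nucR _ _ (@nuc_associator y z x)) associatorP.
Qed.

(** Each of [z], [x] and [z * x] inverts [a], since each is the last entry of an
associator equal to [a]; but conjugating by [z * x] inverts twice. *)
Lemma associator_sqr x y z : associator x y z * associator x y z = 1.
Proof.
set a := associator x y z; have Na : N a := @nuc_associator x y z.
have az : a ^ z = a^-1 := associator_conj_last x y z.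
have ax : a ^ x = a^-1 by rewrite /a -associator_cycle associator_conj_last.
have : a ^ (z * x) = a^-1.
  by rewrite /a -associator_cycle -associator_mulr associator_conj_last.
rewrite (conjgM _ _ Na) az (conjVg _ Na) ax invK => {1}->.
exact: mulVx.
Qed.

(** * The action by conjugation on the associator subloop *)

Lemma associator_subloopP a : A a ->
  [/\ N a, forall n, N n -> commute a n & a * a = 1].
Proof.
pose B : set Q := [set a | [/\ N a, forall n, N n -> commute a n & a * a = 1]].
apply: (_ : A `<=` B); apply: smallest_sub => [|_ [x [y [z ->]]]]; last first.
  split; [exact: nuc_associator | exact: associator_nucC | exact: associator_sqr].
have BM x y : B x -> B y -> B (x * y).
  move=> [Nx Cx xx] [Ny Cy yy]; split; first exact: nuc_mul.
    move=> n Nn; rewrite /commute -(nucL _ _ Nx) (Cy n Nn) (nucL _ _ Nx).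
    by rewrite (Cx n Nn) (nucL _ _ Nn).
  by rewrite {1}(Cx y Ny) -(nucL _ _ Ny) (nucL _ _ Nx) xx mul1g.
split=> //.
- by split=> [|n _|]; rewrite /commute ?mul1g ?mulg1 //; apply: nuc1.
- move=> x y Bx By; have [Nx _ xx] := Bx.
  suff <- : x * y = ldiv x y by apply: BM.
  by apply: (proj1 (ldivP _ _ _)); rewrite (nucL _ _ Nx) xx mul1g.
- move=> x y Bx By; have [Ny _ yy] := By.
  suff <- : x * y = rdiv x y by apply: BM.
  by apply: (proj1 (rdivP _ _ _)); rewrite -(nucR _ _ Ny) yy mulg1.
Qed.

Lemma subloop_associator_subloop : is_subloop A.
Proof.
split=> [H [[]] //|x y Ax Ay H HH|x y Ax Ay H HH|x y Ax Ay H HH].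
- by have [[_ HM _ _] _] := HH; apply: HM; [apply: Ax | apply: Ay].
- by have [[_ _ Hl _] _] := HH; apply: Hl; [apply: Ax | apply: Ay].
- by have [[_ _ _ Hr] _] := HH; apply: Hr; [apply: Ax | apply: Ay].
Qed.

Lemma associator_subloop_associator x y z : A (associator x y z).
Proof. by move=> H [_]; apply; exists x, y, z. Qed.

(** Pentagon: both sides multiply [x(y.zw)] to [(xy.z)w], along the two paths
between these bracketings. *)
Lemma associator_conj x y z w :
  associator y z w * associator x (y * z) w * associator x y z ^ w =
  associator x y (z * w) * associator (x * y) z w.
Proof.
have Na := nuc_associator.
have Nw : N (associator x y z ^ w) by apply/nuc_conj/Na.
apply: (@lmulI (x * (y * (z * w)))).
rewrite (nucR _ _ Nw) !(nucR _ _ (Na _ _ _)).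
rewrite -(nucR _ _ (Na y z w)) !associatorP.
by rewrite -(nucR _ _ Nw) mul_conj (nucM _ _ (Na x y z)) associatorP.
Qed.

Lemma associator_subloop_conj a w : A a -> A (a ^ w).
Proof.
have [A1 AM Aldiv _] := subloop_associator_subloop.
pose B : set Q := [set a | A a /\ A (a ^ w)].
suff : A `<=` B by move=> AB /AB[].
apply: smallest_sub => [|_ [x [y [z ->]]]]; last first.
  have Aa := associator_subloop_associator; split=> //.
  have /ldivP -> := associator_conj x y z w.
  by apply: (Aldiv); apply: (AM).
have NA u : A u -> N u by case/associator_subloopP.
have BM x y : B x -> B y -> B (x * y).
  move=> [Ax Axw] [Ay Ayw]; split; first exact: AM.
  by rewrite conjMg; [apply: AM|apply: NA..].
split=> //.
- by split=> //; rewrite conj_commute // /commute mulg1 mul1g.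
- move=> x y Bx By; suff <- : x * y = ldiv x y by apply: BM.
  have [/associator_subloopP[Nx _ xx] _] := Bx.
  by apply: (proj1 (ldivP _ _ _)); rewrite (nucL _ _ Nx) xx mul1g.
- move=> x y Bx By; suff <- : x * y = rdiv x y by apply: BM.
  have [/associator_subloopP[Ny _ yy] _] := By.
  by apply: (proj1 (rdivP _ _ _)); rewrite -(nucR _ _ Ny) yy mulg1.
Qed.

Lemma conj_nuc_trivial a n : A a -> N n -> a ^ n = a.
Proof. by case/associator_subloopP=> _ aC _ /aC; apply: conj_commute. Qed.

Lemma conj_invol a w : A a -> (a ^ w) ^ w = a.
Proof.
move=> Aa; have [Na _ _] := associator_subloopP Aa.
by rewrite -conjgM // (conj_nuc_trivial Aa (nuc_sqr w)).
Qed.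

Lemma conj_exchange a u v : A a -> (a ^ u) ^ v = (a ^ v) ^ u.
Proof.
move=> Aa; have [Na _ _] := associator_subloopP Aa.
have [n Nn uv] := eqN_mulC u v.
rewrite -!conjgM // uv (conjgM _ n Na).
by rewrite (conj_nuc_trivial (associator_subloop_conj _ Aa) Nn).
Qed.

(** Descent on a finite set [F] containing the orbit of [a]: when [w] moves [a],
the orbit of [g a] lies in [g (F \ a)] for [g u = u * u ^ w], because
[g a = g (a ^ w)] makes [a] redundant. *)
Lemma exists_conj_fixed (F : {fset Q}) a :
    A a -> a <> 1 -> (forall w, a ^ w \in F) ->
  exists b, [/\ A b, b <> 1 & forall w, b ^ w = b].
Proof.
have [m] := ubnP #|` F|; elim: m => // m IHm in F a * => ltFm Aa a1 aF.
have [fixa|/existsNP[w wa]] := pselect (forall w, a ^ w = a); first by exists a.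
have [Na _ aa] := associator_subloopP Aa.
have [_ AM _ _] := subloop_associator_subloop.
have Aconj v : A (a ^ v) by apply: associator_subloop_conj.
pose g u := u * u ^ w.
have ga : g (a ^ w) = g a.
  rewrite /g conj_invol //.
  by have [_ aC _] := associator_subloopP Aa; rewrite -aC //; apply: nuc_conj.
have gconj v : g a ^ v = g (a ^ v).
  by rewrite /g (conjMg _ Na (nuc_conj _ Na)) (conj_exchange _ _ Aa).
have aFa : a \in F by rewrite -(conj1 a).
apply: (IHm [fset g u | u in F `\ a]%fset (g a)).
- rewrite (leq_ltn_trans (leq_imfset_card _ _ _)) //=.
  by move: ltFm; rewrite (cardfsD1 a) aFa add1n ltnS.
- exact: AM.
- rewrite /g => ga1; apply: wa; apply: (@lmulI a).
  by rewrite ga1 aa.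
- move=> v; rewrite gconj.
  have [-> | va] := eqVneq (a ^ v) a.
    by rewrite -ga; apply: in_imfset; rewrite !inE aF andbT; apply/eqP.
  by apply: in_imfset; rewrite !inE aF va.
Qed.

End ExtraLoop.

Theorem theorem6p1 (Q : loopType) :
  extra_loop Q ->
  ~ (forall x y z : Q, x * (y * z) = (x * y) * z)%g ->
  finite_set (associator_subloop Q) ->
  (1 < #|` fset_set (loop_center Q `&` associator_subloop Q)|)%N.
Proof.
move=> extraQ nassocQ finA.
have [a Aa a1] : exists2 a, associator_subloop Q a & a <> 1%g.
  apply: contra_notP nassocQ => noA x y z.
  rewrite -(associatorP x y z).
  have -> : associator x y z = 1%g; last by rewrite mulg1.
  apply: contra_notP noA => xyz1.
  by exists (associator x y z) => //; apply: associator_subloop_associator.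
have aF w : loop_conj a w \in fset_set (associator_subloop Q).
  by rewrite in_fset_set // inE; apply: associator_subloop_conj.
have [b [Ab b1 bfix]] := exists_conj_fixed extraQ Aa a1 aF.
have [Nb _ _] := associator_subloopP extraQ Ab.
have finZA : finite_set (loop_center Q `&` associator_subloop Q).
  by apply: sub_finite_set finA => x [].
have [A1 _ _ _] := subloop_associator_subloop Q.
have <- : #|` [fset 1%g; b]%fset| = 2.
  by rewrite cardfs2 eq_sym; move/eqP: b1 => ->.
apply/fsubset_leq_card/fsubsetP => x.
rewrite in_fset_set // in_fset2 => /orP[]/eqP ->; rewrite inE; split=> //; split=> //.
- exact: nuc1.
- by move=> x'; rewrite /commute mul1g mulg1.
- by move=> w; rewrite /commute -{2}(bfix w) mul_conj.
Qed.
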